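(* For an integer $L\ge0$ let $Y_L$ be the graph with vertex set $\{x_0,x_1,\dots,x_L=c,u,v\}$ ($L+3$ distinct vertices) and edge set $\{x_{i-1}x_i:1\le i\le L\}\cup\{cu,cv\}$. For $\lambda\ge0$ put $D_L(\lambda)=(L+1)+(2L+1)\lambda$, and let $\delta_x(\lambda)$ be the change of the expected cover time from start $x$ when the edge $uv$ is inserted in $Y_L$ with conductance $\lambda$. Then for $0\le j\le L$, $$\delta_{x_j}(\lambda)=2\lambda\left[j-\frac{2L+3}{1+2\lambda}+\frac{jL(L+3)}{(L+1)D_L(\lambda)}\right],$$ and $$\delta_u(\lambda)=\delta_v(\lambda)=\lambda\left[2L+1-\frac{2(2L+3)}{1+2\lambda}+\frac{L(L+3)(2L+1)}{(L+1)D_L(\lambda)}\right].$$ At $\lambda=1$ none of these responses vanishes, for any start vertex of $Y_L$. More precisely, for $L\ge1$ and $0\le j\le L$, $$\delta_{x_j}(1)<0\iff 0\le 2j\le L+1,$$ and $\delta_{x_j}(1)>0$ for all remaining $j$. When $L=0$, $\delta_{x_0}(1)=-2$. Moreover $$\delta_u(1)=\delta_v(1)=\frac{2(6L^3+11L^2-L-3)}{3(L+1)(3L+2)},$$ which equals $-1$ for $L=0$ and is strictly positive for every $L\ge1$.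
   Context: Inserting $uv$ with conductance $\lambda$ means: every edge of $Y_L$ has conductance $1$, the edge $uv$ is added with conductance $\lambda$, and the walk moves along an incident edge with probability proportional to its conductance. With $f_x(\lambda)$ the expected cover time of this walk started at $x$ (expected first time at which all vertices have been visited, the start being visited at time $0$), $\delta_x(\lambda)=f_x(\lambda)-f_x(0)$. *)

(* Defs.v *)
From HB Require Import structures.
From mathcomp Require Import all_boot all_order all_algebra.
From mathcomp Require Import all_classical all_reals all_analysis.
From mathcomp Require Import measurable_realfun.

Set Implicit Arguments.
Unset Strict Implicit.
Unset Printing Implicit Defensive.
Import Order.TTheory GRing.Theory Num.Theory.
Local Open Scope classical_set_scope.
Local Open Scope ring_scope.

Section RandomWalk.
Variables (R : realType) (V : finType) (c : V -> V -> R).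

(* [c a b] is the conductance between [a] and [b]; conductance 0 means that
   there is no edge. *)
Definition step_prob (a b : V) : R := c a b / \sum_(z : V) c a z.

(* Probability that the first [size w] steps of the walk started at [x] lead
   successively to the vertices listed in [w]. *)
Definition path_prob (x : V) (w : seq V) : R :=
  \prod_(i < size w) step_prob (nth x (x :: w) i) (nth x w i).

Definition covers (s : seq V) : bool := [forall v : V, v \in s].

(* The trajectory [x :: w] has visited every vertex at time [size w], but not
   at any earlier time [k], when it has visited [x :: take k w]. *)
Definition first_covers (x : V) (w : seq V) : bool :=
  covers (x :: w) && [forall k : 'I_(size w), ~~ covers (x :: take k w)].

Definition cover_time_prob (x : V) (t : nat) : R :=
  \sum_(w : t.-tuple V | first_covers x w) path_prob x w.

(* Expectation of a random variable with values in {0, 1, 2, ..., +oo}; the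
   last term is the contribution of the event that the walk never covers the
   graph (it is 0 if this event has probability 0, since +oo * 0 = 0).
   See [integral_cover_time] below. *)
Definition expected_cover_time (x : V) : \bar R :=
  (\sum_(0 <= t <oo) (t%:R * cover_time_prob x t)%:E
   + +oo * (1 - \sum_(0 <= t <oo) (cover_time_prob x t)%:E))%E.

Definition cover_time (T : Type) (X : nat -> T -> V) (o : T) : \bar R :=
  ereal_inf [set t%:R%:E | t in
    [set t | forall v, exists2 s, (s <= t)%N & X s o = v]].

Definition walk_from d (T : measurableType d) (P : probability T R) (x : V)
    (X : nat -> T -> V) : Prop :=
  [/\ forall o, X 0%N o = x,
      forall t v, measurable (X t @^-1` [set v]) &
      forall w : seq V,
        P [set o | forall i, (i < size w)%N -> X i.+1 o = nth x w i] =
        (path_prob x w)%:E].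

Section Realization.
Variables (d : measure_display) (T : measurableType d) (P : probability T R).
Variables (x : V) (X : nat -> T -> V).
Hypothesis walkX : walk_from P x X.

Let traj t o := [tuple X i.+1 o | i < t].

Let trajE t o i : (i < t)%N -> nth x (traj t o) i = X i.+1 o.
Proof. by move=> it; rewrite -(tnth_nth x _ (Ordinal it)) tnth_mktuple. Qed.

Let take_traj t o k : (k <= t)%N -> take k (traj t o) = traj k o.
Proof.
move=> kt; have sk : size (take k (traj t o)) = k.
  by rewrite size_take_min size_tuple (minn_idPl kt).
apply: (@eq_from_nth _ x) => [|i]; first by rewrite sk size_tuple.
by rewrite sk => ik; rewrite nth_take // !trajE // (leq_trans ik).
Qed.

Let coversP t o :
  reflect (forall v, exists2 s, (s <= t)%N & X s o = v) (covers (x :: traj t o)).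
Proof.
have [X0 _ _] := walkX.
apply: (iffP forallP) => h v.
  have := h v; rewrite inE => /orP[/eqP ->|]; first by exists 0%N.
  move=> /(nthP x)[i]; rewrite size_tuple => it <-.
  by exists i.+1 => //; rewrite trajE.
have [[|s] st <-] := h v; first by rewrite X0 mem_head.
rewrite inE; apply/orP; right; apply/(nthP x); exists s.
  by rewrite size_tuple.
by rewrite trajE.
Qed.

Let E t := [set o | first_covers x (traj t o)].

Let EP t o : E t o <->
  (covers (x :: traj t o) /\ forall k, (k < t)%N -> ~~ covers (x :: traj k o)).
Proof.
rewrite -[E t o]/(is_true (first_covers x (traj t o))) /first_covers; split.
  move=> /andP[-> /forallP h]; split => // k kt.
  have kt' : (k < size (traj t o))%N by rewrite size_tuple.
  by have := h (Ordinal kt'); rewrite [nat_of_ord _]/= take_traj // ltnW.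
move=> [-> h]; rewrite andTb; apply/forallP => -[k kt].
have kt' : (k < t)%N by rewrite -[t in (_ < t)%N](size_tuple (traj t o)).
by rewrite [nat_of_ord _]/= take_traj ?h // ltnW.
Qed.

Let F t (w : t.-tuple V) := [set o | traj t o = w].

Let FE t (w : t.-tuple V) :
  F w = [set o | forall i, (i < size w)%N -> X i.+1 o = nth x w i].
Proof.
apply/seteqP; split=> o /=.
  by move=> <- i; rewrite size_tuple => it; rewrite trajE.
move=> h; apply: val_inj; apply: (@eq_from_nth _ x); rewrite !size_tuple // => i it.
by rewrite trajE // h // size_tuple.
Qed.

Let mF t (w : t.-tuple V) : measurable (F w).
Proof.
have [_ mX _] := walkX.
rewrite (_ : F w = \bigcap_(i in `I_t) (X i.+1 @^-1` [set nth x w i])).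
  by apply: fin_bigcap_measurable => // i _; exact: mX.
by rewrite FE size_tuple; apply/seteqP; split=> o /= h i; exact: h.
Qed.

Let r t := [seq w : t.-tuple V <- index_enum {: t.-tuple V} | first_covers x w].

Let E_bigcup t : E t = \bigcup_(w in [set` r t]) F w.
Proof.
apply/seteqP; split=> [p Ep|p [w wr Fp]].
  by exists (traj t p) => //; rewrite /= mem_filter mem_index_enum andbT.
move: wr; rewrite -[_ w]/(is_true (w \in r t)) mem_filter => /andP[fw _].
by rewrite -[E t p]/(is_true (first_covers x (traj t p))) (Fp : traj t p = w).
Qed.

Let mE t : measurable (E t).
Proof.
by rewrite E_bigcup; apply: fin_bigcup_measurable.
Qed.

Let PE t : P (E t) = (cover_time_prob x t)%:E.
Proof.
have [_ _ PX] := walkX.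
rewrite E_bigcup measure_fin_bigcup //; last first.
  by move=> w1 w2 _ _ [p [/= <- <-]].
rewrite -fsbig_seq ?filter_uniq ?index_enum_uniq //.
rewrite big_filter /cover_time_prob -sumEFin.
by apply: eq_bigr => w _; rewrite -PX -FE.
Qed.

Let tE : trivIset setT E.
Proof.
move=> t1 t2 _ _ [p [/EP[c1 n1] /EP[c2 n2]]].
case: (ltngtP t1 t2) => // [/n2|/n1]; first by rewrite c1.
by rewrite c2.
Qed.

Let cover_time_E t o : E t o -> cover_time X o = t%:R%:E.
Proof.
move=> /EP[/coversP c1 n1]; apply/eqP; rewrite eq_le; apply/andP; split.
  by apply: ereal_inf_lbound; exists t.
apply: le_ereal_inf_tmp => _ [s /= hs <-]; rewrite lee_fin ler_nat leqNgt.
by apply/negP => /n1/negP; apply; apply/coversP.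
Qed.

Let cover_time_nE o : ~ (\bigcup_t E t) o -> cover_time X o = +oo%E.
Proof.
move=> nE; apply/ereal_inf_pinfty => _ [s /coversP hs <-]; exfalso; apply: nE.
have ex : exists s, covers (x :: traj s o) by exists s.
exists (ex_minn ex) => //; apply/EP; case: ex_minnP => t ct mt; split => // k.
by rewrite ltnNge; apply: contra => /mt.
Qed.

Lemma integral_cover_time :
  (\int[P]_o cover_time X o = expected_cover_time x)%E.
Proof.
have mU : measurable (\bigcup_t E t) by exact: bigcup_measurable.
have mfE t : measurable_fun (E t) (cover_time X).
  apply: (eq_measurable_fun (cst t%:R%:E)) => // o /set_mem Eo.
  by rewrite (cover_time_E Eo).
have mfU : measurable_fun (\bigcup_t E t) (cover_time X).
  by apply/measurable_fun_bigcup.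
have mfC : measurable_fun (~` \bigcup_t E t) (cover_time X).
  apply: (eq_measurable_fun (cst +oo%E)) => // o /set_mem nE.
  by rewrite cover_time_nE.
have c0 o : (0 <= cover_time X o)%E.
  by apply: le_ereal_inf_tmp => _ [s _ <-]; rewrite lee_fin.
rewrite -(setUv (\bigcup_t E t)) ge0_integral_setU //; last 3 first.
- exact: measurableC.
- by apply/measurable_funU => //; exact: measurableC.
- by rewrite disj_set2E setICr.
congr (_ + _)%E.
  rewrite ge0_integral_bigcup //.
  apply: eq_eseriesr => t _; rewrite EFinM -PE -integral_cst //.
  by apply: eq_integral => o /set_mem Eo; rewrite (cover_time_E Eo).
rewrite -(eq_eseriesr (fun t _ => PE t)) -measure_semi_bigcup // -probability_setC //.
rewrite -integral_cst; last exact: measurableC.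
by apply: eq_integral => o /set_mem nE; rewrite cover_time_nE.
Qed.

End Realization.
End RandomWalk.

Section EdgeInsertion.
Variables (R : realType) (V : finType).

(* Unit conductances on the edges of the simple graph [e], where moreover the
   edge [uv] is added with conductance [lam]; for [lam = 0] this is [e]. *)
Definition insert_edge (e : rel V) (u v : V) (lam : R) (a b : V) : R :=
  (e a b)%:R + lam * ([set a; b]%SET == [set u; v]%SET)%:R.

Definition cover_time_response (e : rel V) (u v : V) (lam : R) (x : V) : \bar R :=
  (expected_cover_time (insert_edge e u v lam) x
   - expected_cover_time (insert_edge e u v 0) x)%E.

End EdgeInsertion.

(* [inl i] is x_i, so that [inl ord_max] is c; [inr false] is u and [inr true]
   is v. *)
Notation Y_vertex L := ('I_L.+1 + bool)%type.

Definition Y_x (L : nat) (i : 'I_L.+1) : Y_vertex L := inl i.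
Definition Y_u (L : nat) : Y_vertex L := inr false.
Definition Y_v (L : nat) : Y_vertex L := inr true.

Definition Y_edge (L : nat) : rel (Y_vertex L) := fun a b =>
  match a, b with
  | inl i, inl j => (j == i.+1 :> nat) || (i == j.+1 :> nat)
  | inl i, inr _ => i == ord_max
  | inr _, inl j => j == ord_max
  | inr _, inr _ => false
  end.

Section Response.
Variables (R : realType) (L : nat).

Definition D (lam : R) : R := (L%:R + 1) + (2 * L%:R + 1) * lam.

Definition delta (x : Y_vertex L) (lam : R) : \bar R :=
  cover_time_response (@Y_edge L) (Y_u L) (Y_v L) lam x.

End Response.
Arguments D {R} L lam.
Arguments delta {R L} x lam.

(* Main.v *)
(* First-step analysis. A bounded function h of (position, visited set) that
   vanishes when everything is visited and satisfies the first-step equations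
   along all reachable states is the expected remaining cover time. In Y_L a
   walk has covered the graph once it has visited x_0, u and v, so h only
   depends on the position and on which of these three vertices are visited; on
   the path it is a quadratic polynomial of the position with leading
   coefficient -1, and the remaining coefficients solve a linear system. *)
Require Import Defs.
From mathcomp Require Import all_boot all_order all_algebra.
From mathcomp Require Import all_classical all_reals all_analysis.
From mathcomp Require Import ring lra zify.
Import Order.TTheory GRing.Theory Num.Theory.
Import numFieldNormedType.Exports.
Local Open Scope ring_scope.

Set Implicit Arguments.
Unset Strict Implicit.
Unset Printing Implicit Defensive.

(** * Preliminaries: sums over tuples and a limit for monotone summable sequences *)

Lemma big_tuple_cons (R : nmodType) (T : finType) (n : nat)
    (P : pred (seq T)) (F : seq T -> R) :
  \sum_(w : n.+1.-tuple T | P w) F w =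
  \sum_(z : T) \sum_(w : n.-tuple T | P (z :: w)) F (z :: w).
Proof.
rewrite pair_big_dep /=.
rewrite (reindex (fun p : T * n.-tuple T => [tuple of p.1 :: p.2])) //=.
exists (fun w => (thead w, [tuple of behead w])).
- by move=> [z w] _; congr pair; apply: val_inj.
- by move=> w _; rewrite /= -tuple_eta.
Qed.

(** There are at least [n/2] indices in [[n/2, n)], and each carries a term at least [u n]; so
    [n * u n] is at most twice a block of the series, which tends to 0. *)
Lemma cvg_mulrn_nonincreasing (R : realType) (u : nat -> R) :
  (forall n, u n.+1 <= u n) -> (forall n, 0 <= u n) -> cvgn (series u) ->
  ((fun n => n%:R * u n) @ \oo --> (0 : R))%classic.
Proof.
move=> ud u0 cu.
have um m n : (m <= n)%N -> u n <= u m.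
  by apply: (homo_leq (r := fun x y => y <= x)) => // y x z xy yz; exact: le_trans yz xy.
set S := series u; set l := limn S.
have Sl : (S @ \oo --> l)%classic by exact: cu.
have Sh : ((fun n => S (n %/ 2)%N) @ \oo --> l)%classic.
  by apply: (cvg_comp _ _ _ Sl); exact: cvg_divnr.
have : ((fun n => 2 * (S n - S (n %/ 2)%N)) @ \oo --> (0 : R))%classic.
  by rewrite -(mulr0 2) -(subrr l); apply: cvgMr; exact: cvgB.
apply: squeeze_cvgr; last exact: cvg_cst.
near=> n; apply/andP; split; first by rewrite mulr_ge0.
rewrite sub_series_geq ?leq_div //.
apply: (@le_trans _ _ (2 * \sum_(n %/ 2 <= k < n) u n)).
  rewrite sumr_const_nat -[X in _ <= 2 * X]mulr_natl mulrA -natrM ler_wpM2r // ler_nat.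
  by have := leq_trunc_div n 2; lia.
rewrite ler_pM2l // ler_sum_nat // => k /andP[_ kn].
by apply: um; exact: ltnW.
Unshelve. all: by end_near.
Qed.

(** * Survival probabilities and the expected cover time *)

Section Verification.
Local Open Scope set_scope.
Variables (R : realType) (V : finType) (c : V -> V -> R).
Hypothesis c_ge0 : forall a b, 0 <= c a b.
Hypothesis c_gt0 : forall a, 0 < \sum_z c a z.

Let p := step_prob c.

Let p_ge0 a b : 0 <= p a b.
Proof. by rewrite divr_ge0 // ltW. Qed.

Let p_sum1 a : \sum_z p a z = 1.
Proof. by rewrite -mulr_suml divff // gt_eqF. Qed.

(** Probability that the walk at [x], with [A] already visited, has not covered the graph after [n]
    more steps. *)
Fixpoint survival (n : nat) (A : {set V}) (x : V) : R :=
  if A == [set: V] then 0 else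
  if n is m.+1 then \sum_z p x z * survival m (z |: A) z else 1.

Lemma survival_setT n x : survival n [set: V] x = 0.
Proof. by case: n => [|n] /=; rewrite eqxx. Qed.

Lemma survivalS n A x : survival n.+1 A x =
  if A == [set: V] then 0 else \sum_z p x z * survival n (z |: A) z.
Proof. by []. Qed.

Lemma survival_ge0 n A x : 0 <= survival n A x.
Proof.
elim: n A x => [|n IH] A x /=; case: ifP => // _.
by apply: sumr_ge0 => z _; rewrite mulr_ge0.
Qed.

Lemma survival_le1 n A x : survival n A x <= 1.
Proof.
elim: n A x => [|n IH] A x /=; case: ifP => // _.
rewrite -[leRHS](p_sum1 x); apply: ler_sum => z _.
by rewrite ler_piMr.
Qed.

Lemma survivalS_le n A x : survival n.+1 A x <= survival n A x.
Proof.
elim: n A x => [|n IH] A x.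
  rewrite [leRHS]/=; case: eqP => [->|_]; last exact: survival_le1.
  by rewrite survival_setT.
have [->|nA] := eqVneq A [set: V]; first by rewrite !survival_setT.
rewrite !survivalS (negPf nA).
by apply: ler_sum => z _; rewrite ler_wpM2l.
Qed.

(** [first_covers] with the visited prefix [s] as a parameter: each step lengthens the prefix, so an
    induction on [w] needs an arbitrary [s]. *)
Let first_covers_from (s w : seq V) :=
  covers (s ++ w) && [forall k : 'I_(size w), ~~ covers (s ++ take k w)].

Let coversE (s : seq V) : covers s = ([set z in s] == [set: V]).
Proof.
apply/forallP/eqP => [h|/setP h v].
  by apply/setP => v; rewrite !inE h.
by have := h v; rewrite !inE.
Qed.

Let set_rcons (s : seq V) z : [set y in rcons s z] = z |: [set y in s].
Proof. by apply/setP => y; rewrite !inE mem_rcons inE. Qed.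

Let first_covers_cons s z w :
  first_covers_from s (z :: w) =
  ~~ covers s && first_covers_from (rcons s z) w.
Proof.
rewrite /first_covers_from -cat_rcons andbCA; congr andb.
apply/forallP/andP => [h|[h0 /forallP h] [[|k] kw] /=].
- split; first by have := h ord0; rewrite take0 cats0.
  by apply/forallP => k; have := h (lift ord0 k); rewrite /= -cat_rcons.
- by rewrite cats0.
- by rewrite -cat_rcons; exact: (h (Ordinal (kw : (k < size w)%N))).
Qed.

Let path_prob_cons x z w : path_prob c x (z :: w) = p x z * path_prob c z w.
Proof.
rewrite /path_prob big_ord_recl /=; congr (_ * _); apply: eq_bigr => i _ /=.
have iw := ltn_ord i.
by rewrite !(set_nth_default z x) //=; exact: leqW.
Qed.

Let q (t : nat) s x :=
  \sum_(w : t.-tuple V | first_covers_from s w) path_prob c x w.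

Let q0 s x : q 0 s x = (covers s)%:R.
Proof.
rewrite /q big_mkcond (big_pred1 [tuple]) => [|w]; last first.
  by symmetry; apply/eqP/val_inj; rewrite /= (tuple0 w).
rewrite /first_covers_from /= cats0 /path_prob big_ord0.
rewrite (_ : [forall k, _] = true) ?andbT; first by case: ifP.
by apply/forallP; case.
Qed.

Let qS t s x :
  q t.+1 s x = if covers s then 0 else \sum_z p x z * q t (rcons s z) z.
Proof.
rewrite /q big_tuple_cons; case: ifPn => cs.
  by apply: big1 => z _; apply: big_pred0 => w; rewrite first_covers_cons cs.
apply: eq_bigr => z _; rewrite mulr_sumr; apply: eq_big => w.
  by rewrite first_covers_cons cs.
by rewrite path_prob_cons.
Qed.

(** Covering exactly at time [t.+1] means surviving [t] steps but not [t.+1]; both sides obey the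
    same one-step recursion. *)
Let q_survival t s x :
  q t.+1 s x = survival t [set z in s] x - survival t.+1 [set z in s] x.
Proof.
elim: t s x => [|t IH] s x; rewrite qS /= coversE.
  case: ifP => _; first by rewrite subrr.
  rewrite -[X in _ = X - _](p_sum1 x) -sumrB; apply: eq_bigr => z _.
  by rewrite q0 coversE set_rcons; case: ifP => _ /=; ring.
case: ifP => _; first by rewrite subrr.
rewrite -sumrB; apply: eq_bigr => z _.
by rewrite IH set_rcons mulrBr.
Qed.

Let cover_time_probE t x : cover_time_prob c x t = q t [:: x] x.
Proof. by []. Qed.

Let set_1 x : [set z in [:: x]] = [set x] :> {set V}.
Proof. by apply/setP => z; rewrite !inE. Qed.

Let sum_cover_time_prob n x :
  \sum_(0 <= t < n.+1) cover_time_prob c x t = 1 - survival n [set x] x.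
Proof.
elim: n => [|n IH].
  by rewrite big_nat1 cover_time_probE q0 coversE set_1 /=; case: ifP => _ /=; ring.
rewrite big_nat_recr // IH cover_time_probE q_survival set_1; exact: subrKA.
Qed.

(** Summation by parts; once the survival series converges, [cvg_mulrn_nonincreasing] sends the
    boundary term to 0. *)
Let sum_cover_time n x :
  \sum_(0 <= t < n.+1) t%:R * cover_time_prob c x t =
  series (fun t => survival t [set x] x) n - n%:R * survival n [set x] x.
Proof.
rewrite /series /=; elim: n => [|n IH].
  by rewrite big_nat1 big_geq // !mul0r subr0.
rewrite big_nat_recr // IH [in RHS]big_nat_recr //.
rewrite cover_time_probE q_survival set_1 -natr1; set b := survival n.+1 _ _.
by rewrite /=; ring.
Qed.

(* No irreducibility is needed: summability of the survival probabilities makes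
   the cover time finite. *)
Lemma expected_cover_time_survival x (l : R) :
  (series (fun t => survival t [set x] x) @ \oo --> l)%classic ->
  expected_cover_time c x = l%:E.
Proof.
move=> sl; set u := fun t => survival t [set x] x.
have cu : cvgn (series u) by apply/cvg_ex; exists l.
have u0 : (u @ \oo --> (0 : R))%classic by exact: cvg_series_cvg_0.
have nu0 := cvg_mulrn_nonincreasing (fun n => survivalS_le n [set x] x)
  (fun n => survival_ge0 n [set x] x) cu.
rewrite /expected_cover_time.
have -> : (\sum_(0 <= t <oo) (t%:R * cover_time_prob c x t)%:E)%E = l%:E.
  apply/cvg_lim => //; rewrite -cvg_shiftS.
  under eq_cvg do rewrite /= sumEFin sum_cover_time.
  by apply: cvg_EFin; [exact: nearW|rewrite -(subr0 l); exact: cvgB].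
have -> : (\sum_(0 <= t <oo) (cover_time_prob c x t)%:E)%E = 1%:E.
  apply/cvg_lim => //; rewrite -cvg_shiftS.
  under eq_cvg do rewrite /= sumEFin sum_cover_time_prob.
  apply: cvg_EFin; [exact: nearW|rewrite -[1 in X in (_ --> X)%classic](subr0 1)].
  by apply: cvgB => //; exact: cvg_cst.
by rewrite subee // mule0 adde0.
Qed.

(** * Solutions of the first-step equations *)

Section Harmonic.
(** [I] restricts the states at which equations are required. [h_step] is the first-step equation
    multiplied by the total conductance, so checking it involves no division. *)
Variables (I : V -> {set V} -> Prop) (h : V -> {set V} -> R).
Hypothesis I_step : forall x A z, I x A -> A != [set: V] -> 0 < c x z -> I z (z |: A).
Hypothesis h_setT : forall x, h x [set: V] = 0.
Hypothesis h_step : forall x A, I x A -> A != [set: V] ->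
  \sum_z c x z * (h x A - h z (z |: A) - 1) = 0.

(** Expectation of [h] after [n] further steps; covered states count as 0, in accordance with
    [h_setT]. *)
Fixpoint remainder (n : nat) (A : {set V}) (x : V) : R :=
  if n is m.+1 then
    if A == [set: V] then 0 else \sum_z p x z * remainder m (z |: A) z
  else h x A.

Let h_step_prob x A : I x A -> A != [set: V] ->
  h x A = 1 + \sum_z p x z * h z (z |: A).
Proof.
move=> IA nA; have S0 : \sum_z c x z != 0 by rewrite gt_eqF.
have /eqP := h_step IA nA.
rewrite (eq_bigr (fun z => (h x A - 1) * c x z - c x z * h z (z |: A))); last first.
  by move=> z _; ring.
rewrite sumrB -mulr_sumr subr_eq0 => /eqP E.
rewrite (eq_bigr (fun z => (\sum_z c x z)^-1 * (c x z * h z (z |: A)))); last first.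
  by move=> z _; rewrite /p /step_prob; ring.
rewrite -mulr_sumr -E.
by field.
Qed.

(** Iterating the first-step equation: each step taken before covering costs 1, in expectation the
    survival probability. *)
Let h_remainder n x A : I x A ->
  h x A = series (fun t => survival t A x) n + remainder n A x.
Proof.
have [->|nA] := eqVneq A [set: V].
  move=> _; rewrite /series /= big1 => [|t _]; last by rewrite survival_setT.
  by case: n => [|n] /=; rewrite h_setT ?eqxx addr0.
elim: n x A nA => [|n IH] x A nA IA.
  by rewrite /series /= big_geq // add0r.
rewrite h_step_prob // /series /= (negPf nA) big_nat_recl //= (negPf nA) -addrA.
congr (_ + _).
rewrite exchange_big -big_split /=; apply: eq_bigr => z _.
rewrite -mulr_sumr -mulrDr.
(* [I] propagates only along positive conductances; the other terms have step probability 0. *)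
have := c_ge0 x z; rewrite le_eqVlt => /orP[/eqP c0|cp].
  by rewrite /p /step_prob -c0 !mul0r.
congr (_ * _); have IzA := I_step IA nA cp.
have [zA|] := eqVneq (z |: A) [set: V]; last by move=> ?; exact: IH.
rewrite zA big1 => [|t _]; last by rewrite survival_setT.
by case: (n) => [|m] /=; rewrite h_setT ?eqxx addr0.
Qed.

Let M := \sum_x \sum_A `|h x A|.

Let h_le x A : `|h x A| <= M.
Proof.
rewrite /M (bigD1 x) //= (bigD1 A) //= -addrA lerDl addr_ge0 //.
  by apply: sumr_ge0.
by apply: sumr_ge0 => *; apply: sumr_ge0.
Qed.

Let remainder_le n A x : `|remainder n A x| <= M * survival n A x.
Proof.
elim: n A x => [|n IH] A x /=; case: eqP => [AT|_].
- by rewrite AT h_setT normr0 mulr0.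
- by rewrite mulr1.
- by rewrite normr0 mulr0.
rewrite mulr_sumr; apply: (le_trans (ler_norm_sum _ _ _)).
apply: ler_sum => z _; rewrite normrM ger0_norm // mulrCA.
by rewrite ler_wpM2l.
Qed.

(* A solution [h] of the first-step equations need not be nonnegative: being
   bounded, it bounds the partial sums of the survival probabilities, hence
   the remainder tends to 0. *)
Lemma expected_cover_time_harmonic x :
  I x [set x] -> expected_cover_time c x = (h x [set x])%:E.
Proof.
move=> Ix; apply: expected_cover_time_survival.
set u := fun t => survival t [set x] x.
have M0 : 0 <= M by apply: (le_trans _ (h_le x [set x])).
have nd : nondecreasing_seq (series u).
  by apply/nondecreasing_series => n _ _; exact: survival_ge0.
have cu : cvgn (series u).
  apply: nondecreasing_is_cvgn => //; exists (M + M) => _ [n _ <-].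
  have := h_remainder n Ix; rewrite -/u => /eqP; rewrite -subr_eq => /eqP <-.
  apply: lerD; first exact: (le_trans (ler_norm _) (h_le _ _)).
  apply: (le_trans (ler_norm _)); rewrite normrN; apply: (le_trans (remainder_le _ _ _)).
  by rewrite ler_piMr // survival_le1.
have u0 : (u @ \oo --> (0 : R))%classic by exact: cvg_series_cvg_0.
have r0 : ((fun n => remainder n [set x] x) @ \oo --> (0 : R))%classic.
  apply: norm_cvg0; apply: (@squeeze_cvgr _ _ _ _ (fun=> 0) (fun n => M * u n)).
  - by near=> n; rewrite normr_ge0 remainder_le.
  - exact: cvg_cst.
  - by rewrite -(mulr0 M); exact: cvgMr.
have -> : series u = (fun n => h x [set x] - remainder n [set x] x).
  by apply/funext => n; rewrite (h_remainder n Ix) addrK.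
rewrite -[X in (_ --> X)%classic]subr0; apply: cvgB => //; exact: cvg_cst.
Unshelve. all: by end_near.
Qed.

End Harmonic.
End Verification.

(** * The network [Y_L] with the edge [uv] of conductance [lam] *)

Section Tree.
Local Open Scope set_scope.
Variables (R : realType) (L : nat) (lam : R).
Hypothesis lam_ge0 : 0 <= lam.
Notation V := (Y_vertex L).
Notation x_ i := (@Y_x L i).
Notation u := (Y_u L).
Notation v := (Y_v L).

Definition Y_conductance : V -> V -> R := insert_edge (@Y_edge L) u v lam.
Local Notation c := Y_conductance.

Lemma Y_conductance_ge0 a b : 0 <= c a b.
Proof. by rewrite addr_ge0 // mulr_ge0. Qed.

Lemma Y_conductance_path_l i b : c (inl i) b = (Y_edge (inl i) b)%:R.
Proof.
rewrite /c /insert_edge (_ : (_ == _) = false) ?mulr0 ?addr0 //.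
by apply/eqP => /setP /(_ (inl i)); rewrite !inE eqxx.
Qed.

Lemma Y_conductance_path_r a i : c a (inl i) = (Y_edge a (inl i))%:R.
Proof.
rewrite /c /insert_edge (_ : (_ == _) = false) ?mulr0 ?addr0 //.
by apply/eqP => /setP /(_ (inl i)); rewrite !inE eqxx orbT.
Qed.

Lemma Y_conductance_leaves s t : c (inr s) (inr t) = lam * (s != t)%:R.
Proof.
rewrite /c /insert_edge /= add0r; congr (_ * (nat_of_bool _)%:R).
have [->|st] := eqVneq s t; apply/eqP.
  by move=> /setP /(_ (inr (~~ t))); rewrite !inE; case: t.
by apply/setP => -[k|b]; rewrite !inE //; case: s t b st => -[] [].
Qed.

Lemma sum_Y_vertex (F : V -> R) :
  \sum_z F z = \sum_(i < L.+1) F (inl i) + (F u + F v).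
Proof. by rewrite big_sumType big_bool /= [F v + _]addrC. Qed.

Lemma sum_Y_conductance_path (i : 'I_L.+1) (F : V -> R) :
  \sum_z c (inl i) z * F z =
  (if (i < L)%N then F (inl (inord i.+1)) else F u + F v) +
  (if (0 < i)%N then F (inl (inord i.-1)) else 0).
Proof.
rewrite sum_Y_vertex; under eq_bigr do rewrite Y_conductance_path_l.
rewrite !Y_conductance_path_l /= -mulrDr.
have -> : \sum_(z < L.+1) ((z == i.+1 :> nat) || (i == z.+1 :> nat))%:R * F (inl z) =
    (if (i < L)%N then F (inl (inord i.+1)) else 0) +
    (if (0 < i)%N then F (inl (inord i.-1)) else 0).
  rewrite (eq_bigr (fun z : 'I_L.+1 => (z == i.+1 :> nat)%:R * F (inl z) +
    (i == z.+1 :> nat)%:R * F (inl z))); last first.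
    (* The two adjacencies exclude each other, so their disjunction becomes a sum. *)
    move=> z _; rewrite -mulrDl -natrD; congr (_%:R * _).
    by case: eqP; case: eqP => //; lia.
  rewrite big_split /=; congr (_ + _).
    case: ifP => iL.
      rewrite (bigD1 (inord i.+1)) //= inordK // eqxx mul1r big1 ?addr0 // => z.
      by rewrite -val_eqE /= inordK // => /negPf ->; rewrite mul0r.
    rewrite big1 // => z _; case: eqP => [zi|_]; last by rewrite mul0r.
    by have := ltn_ord z; rewrite zi ltnS iL.
  case: ifP => i0.
    have iL : (i.-1 < L.+1)%N by rewrite (leq_ltn_trans (leq_pred i)).
    rewrite (bigD1 (inord i.-1)) //= inordK // prednK // eqxx mul1r big1 ?addr0 // => z.
    rewrite -val_eqE /= inordK // => zi.
    by rewrite (_ : (_ == _) = false) ?mul0r //; lia.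
  rewrite big1 // => z _; case: eqP => [zi|_]; last by rewrite mul0r.
  by rewrite zi in i0.
rewrite -val_eqE /= addrAC; congr (_ + _).
have iL := leq_ord i; rewrite ltn_neqAle iL andbT.
by case: eqP => _ /=; rewrite ?mul1r ?mul0r ?add0r ?addr0.
Qed.

Lemma sum_Y_conductance_leaf b (F : V -> R) :
  \sum_z c (inr b) z * F z = F (inl ord_max) + lam * F (inr (~~ b)).
Proof.
rewrite sum_Y_vertex; under eq_bigr do rewrite Y_conductance_path_r.
rewrite !Y_conductance_leaves /= (bigD1 ord_max) //= eqxx mul1r big1 ?addr0.
  by case: b; rewrite /= ?mulr1 ?mulr0 ?mul0r ?addr0 ?add0r.
by move=> i /negPf ->; rewrite mul0r.
Qed.

Lemma Y_conductance_gt0 a : 0 < \sum_z c a z.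
Proof.
rewrite (eq_bigr (fun z => c a z * 1)) => [|z _]; last by rewrite mulr1.
case: a => [i|b]; rewrite ?sum_Y_conductance_path ?sum_Y_conductance_leaf.
  by case: ifP; case: ifP => _ _; rewrite ?addr0; lra.
by have := lam_ge0; lra.
Qed.

(** * Quadratic profiles and the remaining cover time *)

Definition profile (al be fu fv : R) (x : V) : R :=
  match x with
  | inl i => al + be * i%:R - i%:R ^+ 2
  | inr b => if b then fv else fu
  end.

(** The coefficient -1 settles interior vertices. At [x_0] the missing left neighbour forces
    [be = 0]; the condition on [fu + fv] is the equation at [c]. *)
Lemma profile_path al be fu fv (i : 'I_L.+1) :
  (i = 0%N :> nat -> be = 0) ->
  fu + fv = 2 * (al + be * L%:R - L%:R ^+ 2) + be - 2 * L%:R - 2 ->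
  \sum_z c (inl i) z *
    (profile al be fu fv (inl i) - profile al be fu fv z - 1) = 0.
Proof.
move=> be0 fuv; rewrite sum_Y_conductance_path /=.
have iL := leq_ord i.
have -> : (if (0 < i)%N then al + be * i%:R - i%:R ^+ 2 -
    (al + be * (inord i.-1 : 'I_L.+1)%:R - (inord i.-1 : 'I_L.+1)%:R ^+ 2) - 1 else 0) =
    be - 2 * i%:R :> R.
  case: ifP => [i0|/negbT]; last first.
    by rewrite -eqn0Ngt => /eqP i0; rewrite i0 be0 // mulr0 subr0.
  rewrite inordK ?(leq_ltn_trans (leq_pred i)) //.
  have -> : i%:R = i.-1%:R + 1 :> R by rewrite natr1 prednK.
  by rewrite /=; ring.
case: ltnP => iL'.
  by rewrite inordK // -natr1; ring.
have -> : i = L :> nat by apply/eqP; rewrite eqn_leq iL.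
by rewrite (_ : fv = fu + fv - fu); [rewrite fuv|]; ring.
Qed.

Lemma profile_leaf al be fu fv b :
  (1 + lam) * profile al be fu fv (inr b) =
    al + be * L%:R - L%:R ^+ 2 + lam * profile al be fu fv (inr (~~ b)) +
    (1 + lam) ->
  \sum_z c (inr b) z *
    (profile al be fu fv (inr b) - profile al be fu fv z - 1) = 0.
Proof.
move=> E; rewrite sum_Y_conductance_leaf /=; move: E.
by case: b => /=; lra.
Qed.

(* Expected hitting times: [hit_leaf_c], [hit_leaf_sib] of [v] from [c], [u];
   [hit_end_leaf] of [x_0] from [u]. The others are: [both_leaves_c], the time
   to visit [u] and [v] from [c]; [end_leaf_sib], the time to visit [x_0] and
   [v] from [u]. The two slopes are coefficients of the expected remaining time
   as a quadratic function of the position on the path. *)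
Definition hit_leaf_c : R := (2 * L%:R + 3) * (1 + lam) / (1 + 2 * lam).
Definition hit_leaf_sib : R := 1 + hit_leaf_c / (1 + lam).
Definition hit_end_leaf : R := L%:R * (L%:R + 4 + 2 * lam) + 1 + lam.
Definition slope_end_leaf : R := hit_end_leaf * (1 + 2 * lam) / D L lam.
Definition end_leaf_sib : R :=
  1 + (lam * hit_end_leaf + hit_leaf_c + slope_end_leaf * L%:R) / (1 + lam).
Definition both_leaves_c : R := L%:R + 1 + hit_leaf_sib.
Definition slope_all : R := 2 * (end_leaf_sib - hit_leaf_sib) / (2 * L%:R + 1).

(* Expected remaining cover time, where the booleans tell whether [x_0], [u]
   and [v] have been visited. *)
Definition remaining (b0 bu bv : bool) : V -> R :=
  match b0, bu, bv with
  | true, true, true => fun=> 0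
  | false, true, true =>
      profile 0 (2 * L%:R + 4 + 2 * lam) hit_end_leaf hit_end_leaf
  | true, true, false => profile (hit_leaf_c + L%:R ^+ 2) 0 hit_leaf_sib 0
  | true, false, true => profile (hit_leaf_c + L%:R ^+ 2) 0 0 hit_leaf_sib
  | false, true, false =>
      profile (hit_leaf_c + L%:R ^+ 2) slope_end_leaf end_leaf_sib hit_end_leaf
  | false, false, true =>
      profile (hit_leaf_c + L%:R ^+ 2) slope_end_leaf hit_end_leaf end_leaf_sib
  | true, false, false =>
      profile (L%:R ^+ 2 + both_leaves_c) 0 hit_leaf_sib hit_leaf_sib
  | false, false, false =>
      profile (L%:R ^+ 2 + both_leaves_c) slope_all end_leaf_sib end_leaf_sib
  end.

Definition remaining_time (x : V) (A : {set V}) : R :=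
  remaining (inl ord0 \in A) (u \in A) (v \in A) x.

(** At a landmark ([x_0], [u] or [v]) not yet visited, each profile already holds the value of the
    next stage. Hence a first-step equation involves a single profile, although the visited set
    changes. *)
Lemma remaining_time_visit z A :
  remaining_time z (z |: A) = remaining (inl ord0 \in A) (u \in A) (v \in A) z.
Proof.
rewrite /remaining_time !inE; case: z => [i|[]] /=; rewrite ?eqxx ?orTb ?orFb /=.
- have -> : (inl ord0 == inl i :> V) = (ord0 == i) by [].
  case: eqP => [<-|_] //=.
  (* At position 0 only the constant term of a profile survives, and the two stages share it. *)
  by case: (inl ord0 \in A); case: (u \in A); case: (v \in A) => //=; ring.
- by case: (inl ord0 \in A); case: (u \in A); case: (v \in A).
- by case: (inl ord0 \in A); case: (u \in A); case: (v \in A).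
Qed.

Let lam1_neq0 : 1 + lam != 0.
Proof. by rewrite gt_eqF //; have := lam_ge0; lra. Qed.

Let lam2_neq0 : 1 + 2 * lam != 0.
Proof. by rewrite gt_eqF //; have := lam_ge0; lra. Qed.

Let L2_neq0 : 2 * L%:R + 1 != 0 :> R.
Proof. by rewrite gt_eqF //; have := ler0n R L; lra. Qed.

Let D_neq0 : D L lam != 0.
Proof.
rewrite gt_eqF // /D; have L0 := ler0n R L.
have : 0 <= (2 * L%:R + 1) * lam by rewrite mulr_ge0 //; lra.
lra.
Qed.

(** If [x_0] has been visited the slope is 0, otherwise the walk is not at [x_0]; what is left is
    the equation at [c], which the constants satisfy in each of the seven incomplete stages. *)
Lemma remaining_path b0 bu bv (i : 'I_L.+1) :
  ~~ [&& b0, bu & bv] -> (i = 0%N :> nat -> b0) ->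
  \sum_z c (inl i) z *
    (remaining b0 bu bv (inl i) - remaining b0 bu bv z - 1) = 0.
Proof.
case: b0 bu bv => -[] [] //= _ i0; apply: profile_path => //; try by move/i0.
all: rewrite /slope_all /both_leaves_c /end_leaf_sib /slope_end_leaf.
all: rewrite /hit_leaf_sib /hit_end_leaf /hit_leaf_c.
all: move: D_neq0; rewrite /D => D0; field.
all: by rewrite ?L2_neq0 ?lam1_neq0 ?lam2_neq0 ?D0.
Qed.

(** Claimed only at a visited leaf: at an unvisited one the profile holds the value of a later
    stage. *)
Lemma remaining_leaf b0 bu bv b :
  ~~ [&& b0, bu & bv] -> (if b then bv else bu) ->
  \sum_z c (inr b) z *
    (remaining b0 bu bv (inr b) - remaining b0 bu bv z - 1) = 0.
Proof.
case: b b0 bu bv => -[] [] [] // _ _; apply: profile_leaf.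
all: cbv beta iota delta [profile negb].
all: rewrite /slope_all /both_leaves_c /end_leaf_sib /slope_end_leaf.
all: rewrite /hit_leaf_sib /hit_end_leaf /hit_leaf_c.
all: move: D_neq0; rewrite /D => D0; field.
all: by rewrite ?L2_neq0 ?lam1_neq0 ?lam2_neq0 ?D0.
Qed.

(* The visited set is connected and contains the current position. *)
Definition reachable_state (x : V) (A : {set V}) : Prop :=
  x \in A /\
  match x with
  | inl i =>
    (inl ord0 \in A -> forall k : 'I_L.+1, (k <= i)%N -> inl k \in A) /\
    ((u \in A) || (v \in A) -> forall k : 'I_L.+1, (i <= k)%N -> inl k \in A)
  | inr _ => inl ord0 \in A -> forall k : 'I_L.+1, inl k \in A
  end.

(** Path vertices before the position are visited because [x_0] is, those after it because a leaf
    is. From a leaf, [x_0] alone gives the whole path. *)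
Lemma reachable_state_covers x A : reachable_state x A ->
  [&& inl ord0 \in A, u \in A & v \in A] -> A = [set: V].
Proof.
move=> [xA IA] /and3P[A0 Au Av]; apply/setP => -[k|[]]; rewrite !inE //.
case: x IA {xA} => [i [h1 h2]|b /(_ A0 k) //].
by case: (leqP k i) => [/(h1 A0)//|/ltnW/h2 ->//]; rewrite Au.
Qed.

Lemma reachable_state_step x A z :
  reachable_state x A -> 0 < c x z -> reachable_state z (z |: A).
Proof.
move=> [xA IA] cxz; split; first by rewrite !inE eqxx.
case: x z xA IA cxz => [i|b] [k|b'] xA IA;
  rewrite ?Y_conductance_path_l ?Y_conductance_path_r ?Y_conductance_leaves /=
    ?ltr0n ?lt0b.
- move=> ik; have [ki ik1] : (k <= i.+1)%N /\ (i <= k.+1)%N.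
    by case/orP: ik => /eqP ->; split; rewrite // !leqW.
  case: IA => h1 h2; split.
    rewrite !inE => /orP[/eqP[k0] j|A0 j jk].
      rewrite -k0 leqn0 => /eqP j0.
      by rewrite !inE (_ : j = ord0) ?eqxx //; exact: val_inj.
    rewrite !inE; have [->|jk'] := eqVneq j k; first by rewrite eqxx.
    by rewrite (h1 A0) ?orbT // -ltnS (leq_trans _ ki) // ltn_neqAle jk andbT.
  rewrite !inE /= => uv j kj.
  rewrite !inE; have [->|jk] := eqVneq j k; first by rewrite eqxx.
  rewrite (h2 uv) ?orbT // (leq_trans ik1) // ltn_neqAle kj andbT.
  by rewrite eq_sym.
- have [iL _|_] := eqVneq i ord_max; last by [].
  case: IA => h1 h2; rewrite !inE /= => A0 j; rewrite !inE /=.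
  by apply: h1 => //; rewrite iL -ltnS.
- have [-> _|_] := eqVneq k ord_max; last by [].
  split; rewrite !inE /=.
    (* In the first alternative [x_0] is [c] itself: [L = 0] and the path is one vertex. *)
    move=> /orP[/eqP[k0] j _|A0 j jk].
      rewrite !inE (_ : j = ord_max) ?eqxx //; apply: val_inj => /=.
      by have := ltn_ord j; move: k0; clear; lia.
    by rewrite !inE IA ?orbT.
  move=> _ j Lj; rewrite !inE (_ : j = ord_max) ?eqxx //.
  by apply/val_inj/eqP; rewrite eqn_leq Lj -ltnS ltn_ord.
- by move=> _; rewrite !inE /= => A0 j; rewrite !inE IA // orbT.
Qed.

Lemma expected_cover_time_Y x :
  expected_cover_time c x = (remaining false false false x)%:E.
Proof.
rewrite (@expected_cover_time_harmonic _ _ c Y_conductance_ge0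
  Y_conductance_gt0 reachable_state remaining_time).
(* The start counts as a visit to [x] from the empty set, so every start vertex uses the profile
   with no landmark visited. *)
- by rewrite -[[set x]]finset.setU0 remaining_time_visit !inE.
- by move=> {}x A z IA _; exact: reachable_state_step.
- by move=> {}x; rewrite /remaining_time !inE.
- move=> {}x A IA nA; under eq_bigr do rewrite remaining_time_visit.
  have nb : ~~ [&& inl ord0 \in A, u \in A & v \in A].
    by apply: contra nA => /(reachable_state_covers IA) ->.
  rewrite /remaining_time; case: x IA => [i|b] [xA _].
    apply: remaining_path => // i0.
    by rewrite (_ : ord0 = i) //; exact: val_inj.
  by apply: remaining_leaf => //; case: b xA.
split; first by rewrite !inE.
case: x => [i|b]; rewrite !inE //=; split => //.
move=> /eqP[i0] j; rewrite -i0 leqn0 => /eqP j0; rewrite !inE.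
by rewrite (_ : j = ord0) //; exact: val_inj.
Qed.

End Tree.

(** * Closed forms of the response and its signs at [lam = 1] *)

Section Response.
Variables (R : realType) (L : nat).
Implicit Type lam : R.

Let L_ge0 : 0 <= L%:R :> R := ler0n R L.

Let D_gt0 lam : 0 <= lam -> 0 < D L lam.
Proof.
move=> lam0; have : 0 <= (2 * L%:R + 1) * lam.
  by rewrite mulr_ge0 //; have := L_ge0; lra.
by rewrite /D; have := L_ge0; lra.
Qed.

Lemma delta_remaining lam (x : Y_vertex L) : 0 <= lam ->
  delta x lam = (remaining lam false false false x -
                 remaining 0 false false false x)%:E.
Proof.
move=> lam0; rewrite /delta /cover_time_response.
by rewrite -![expected_cover_time _ _]/(expected_cover_time (Y_conductance _) _)
  !expected_cover_time_Y.
Qed.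

Lemma delta_path lam (j : 'I_L.+1) : 0 <= lam ->
  delta (Y_x j) lam =
  (2 * lam * (j%:R - (2 * L%:R + 3) / (1 + 2 * lam)
    + (j%:R * L%:R * (L%:R + 3)) / ((L%:R + 1) * D L lam)))%:E.
Proof.
move=> lam0; rewrite delta_remaining //; congr (_%:E).
cbv beta iota delta [remaining profile Y_x].
rewrite /slope_all /both_leaves_c /end_leaf_sib.
rewrite /slope_end_leaf /hit_leaf_sib /hit_end_leaf /hit_leaf_c.
have := D_gt0 lam0; rewrite /D !mulr0 !addr0 => /lt0r_neq0 D0; field.
rewrite D0 !lt0r_neq0 //=; have := L_ge0; lra.
Qed.

Lemma delta_leaf lam (b : bool) : 0 <= lam ->
  delta (inr b : Y_vertex L) lam =
  (lam * (2 * L%:R + 1 - (2 * (2 * L%:R + 3)) / (1 + 2 * lam)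
    + (L%:R * (L%:R + 3) * (2 * L%:R + 1)) / ((L%:R + 1) * D L lam)))%:E.
Proof.
move=> lam0; rewrite delta_remaining //; congr (_%:E).
cbv beta iota delta [remaining profile].
have ifE (r : R) : (if b then r else r) = r by case: b.
rewrite !ifE.
rewrite /end_leaf_sib /slope_end_leaf /hit_leaf_sib /hit_end_leaf /hit_leaf_c.
have := D_gt0 lam0; rewrite /D !mulr0 !addr0 => /lt0r_neq0 D0; field.
rewrite D0 !lt0r_neq0 //=; have := L_ge0; lra.
Qed.

(** Over a positive denominator, the sign is that of a numerator affine in [j]. *)
Lemma delta_path1 (j : 'I_L.+1) :
  delta (Y_x j) (1 : R) =
  (2 * (j%:R * (12 * L%:R ^+ 2 + 24 * L%:R + 6) -
        (2 * L%:R + 3) * (L%:R + 1) * (3 * L%:R + 2))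
   / (3 * (L%:R + 1) * (3 * L%:R + 2)))%:E.
Proof.
rewrite delta_path //; congr (_%:E); rewrite /D; field.
by rewrite !lt0r_neq0 //=; have := L_ge0; lra.
Qed.

Lemma delta_leaf1 (b : bool) :
  delta (inr b : Y_vertex L) (1 : R) =
  ((2 * (6 * L%:R ^+ 3 + 11 * L%:R ^+ 2 - L%:R - 3))
     / (3 * (L%:R + 1) * (3 * L%:R + 2)))%:E.
Proof.
rewrite delta_leaf //; congr (_%:E); rewrite /D; field.
by rewrite !lt0r_neq0 //=; have := L_ge0; lra.
Qed.

Let den_gt0 : 0 < 3 * (L%:R + 1) * (3 * L%:R + 2) :> R.
Proof. by rewrite !mulr_gt0 //; have := L_ge0; lra. Qed.

Lemma delta_path1_lt0 (j : 'I_L.+1) : (2 * j <= L + 1)%N ->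
  (delta (Y_x j) (1 : R) < 0)%E.
Proof.
rewrite -(ler_nat R) natrM natrD => jL; rewrite delta_path1 lte_fin.
rewrite pmulr_llt0 ?invr_gt0 //.
have := L_ge0; set n : R := L%:R in jL *; set k : R := j%:R in jL *; move=> n0.
(* With [P = 6 * n ^+ 2 + 12 * n + 3], half the numerator is [2 * k * P - (n + 1) * (P + n + 3)],
   hence at most [- (n + 1) * (n + 3)]. *)
suff : k * 2 * (6 * n ^+ 2 + 12 * n + 3) <= (n + 1) * (6 * n ^+ 2 + 12 * n + 3) by nra.
by rewrite ler_wpM2r //; [nra|lra].
Qed.

Lemma delta_path1_gt0 (j : 'I_L.+1) : (1 <= L)%N -> (L + 1 < 2 * j)%N ->
  (0 < delta (Y_x j) (1 : R))%E.
Proof.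
move=> L1; rewrite -(ler_nat R) -natr1 natrM natrD => jL.
rewrite delta_path1 lte_fin divr_gt0 //.
have : 1 <= L%:R :> R by rewrite ler1n.
set n : R := L%:R in jL *; set k : R := j%:R in jL *; move=> n1.
(* By integrality [2 * k >= n + 2], so half the numerator is at least [5 * n ^+ 2 + 8 * n]. *)
suff : (n + 2) * (6 * n ^+ 2 + 12 * n + 3) <= k * 2 * (6 * n ^+ 2 + 12 * n + 3) by nra.
by rewrite ler_wpM2r //; [nra|lra].
Qed.

Lemma delta_leaf1_gt0 (b : bool) : (1 <= L)%N ->
  (0 < delta (inr b : Y_vertex L) (1 : R))%E.
Proof.
move=> L1; rewrite delta_leaf1 lte_fin divr_gt0 //.
by have : 1 <= L%:R :> R by [rewrite ler1n]; nra.
Qed.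

End Response.

Theorem theorem5p1 (R : realType) (L : nat) :
  (forall lam : R, 0 <= lam ->
    (forall j : 'I_L.+1,
      delta (Y_x j) lam =
        (2 * lam * (j%:R - (2 * L%:R + 3) / (1 + 2 * lam)
          + (j%:R * L%:R * (L%:R + 3)) / ((L%:R + 1) * D L lam)))%:E) /\
    delta (Y_u L) lam = delta (Y_v L) lam /\
    delta (Y_v L) lam =
      (lam * (2 * L%:R + 1 - (2 * (2 * L%:R + 3)) / (1 + 2 * lam)
        + (L%:R * (L%:R + 3) * (2 * L%:R + 1)) / ((L%:R + 1) * D L lam)))%:E) /\
  (forall x : Y_vertex L, delta x (1 : R) <> 0%E) /\
  ((1 <= L)%N -> forall j : 'I_L.+1,
    ((delta (Y_x j) (1 : R) < 0)%E <-> (0 <= 2 * j <= L + 1)%N) /\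
    (~ (0 <= 2 * j <= L + 1)%N -> (0 < delta (Y_x j) (1 : R))%E)) /\
  (L = 0%N -> delta (Y_x (ord0 : 'I_L.+1)) (1 : R) = (- 2)%:E) /\
  delta (Y_u L) (1 : R) = delta (Y_v L) (1 : R) /\
  delta (Y_v L) (1 : R) =
    ((2 * (6 * L%:R ^+ 3 + 11 * L%:R ^+ 2 - L%:R - 3))
     / (3 * (L%:R + 1) * (3 * L%:R + 2)))%:E /\
  (L = 0%N ->
    delta (Y_u L) (1 : R) = (- 1)%:E /\ delta (Y_v L) (1 : R) = (- 1)%:E) /\
  ((1 <= L)%N ->
    (0 < delta (Y_u L) (1 : R))%E /\ (0 < delta (Y_v L) (1 : R))%E).
Proof.
have leaf0 b : L = 0%N -> delta (inr b : Y_vertex L) (1 : R) = (- 1)%:E.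
  by move=> L0; rewrite delta_leaf1 L0; congr (_%:E); field.
split.
  by move=> lam lam0; rewrite !delta_leaf //; do !split => // j; exact: delta_path.
split.
  move=> [j|b].
    have [jL|Lj] := leqP (2 * j) (L + 1).
      by move=> d0; have := delta_path1_lt0 R jL; rewrite /Y_x d0 ltxx.
    (* [L + 1 < 2 * j] together with [j <= L] excludes [L = 0]. *)
    have L1 : (1 <= L)%N by have := ltn_ord j; lia.
    by move=> d0; have := delta_path1_gt0 R L1 Lj; rewrite /Y_x d0 ltxx.
  have [/leaf0->|] := posnP L; first by case; lra.
  by move=> /(delta_leaf1_gt0 R b) /[swap] ->; rewrite ltxx.
split.
  move=> L1 j; split; last first.
    by move=> /negP; rewrite -ltnNge; exact: delta_path1_gt0.
  split; last exact: delta_path1_lt0.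
  move=> d0; rewrite /= [(_ <= L + 1)%N]leqNgt; apply/negP => Lj.
  by move: d0; rewrite lt_gtF //; exact: delta_path1_gt0.
split.
  by move=> L0; rewrite delta_path1 /= L0; congr (_%:E); field.
split; first by rewrite !delta_leaf1.
split; first exact: delta_leaf1.
split; first by move=> L0; split; exact: leaf0.
by move=> L1; split; exact: delta_leaf1_gt0.
Qed.
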